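(* Let $P\subset\mathbb{R}^n$ be an $n$-dimensional convex polytope all of whose vertices lie in the union of two distinct parallel hyperplanes $H_0$ and $H_1$; fix the pair $(H_0,H_1)$. For a dissection $\Delta$ of $P$ and an integer $i$ with $1\le i\le n$, let $\Delta_i$ be the set of simplices $T\in\Delta$ having exactly $i$ vertices in $H_0$ (and hence $n+1-i$ vertices in $H_1$), and let $V(i)=\sum_{T\in\Delta_i}V(T)$ be the total volume of the simplices in $\Delta_i$. Then for each $i$ with $1\le i\le n$ the number $V(i)$ depends only on $P$, the pair $(H_0,H_1)$ and $i$, and does not depend on $\Delta$; that is, any two dissections of $P$ give the same value of $V(i)$.
   Context: A dissection of an $n$-dimensional convex polytope $P$ is a representation of $P$ as a union of finitely many non-overlapping (i.e. with pairwise disjoint interiors) non-degenerate $n$-dimensional simplices, each of whose vertices are vertices of $P$. The simplices are not required to intersect in common faces. $V(\cdot)$ denotes $n$-dimensional Euclidean volume. *)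

(* Defs.v *)
From HB Require Import structures.
From mathcomp Require Import all_boot all_order all_algebra.
From mathcomp Require Import finmap.
From mathcomp Require Import all_classical all_reals all_analysis.

Set Implicit Arguments.
Unset Strict Implicit.
Unset Printing Implicit Defensive.

Import Order.TTheory GRing.Theory Num.Theory.
Import numFieldNormedType.Exports.

Local Open Scope fset_scope.
Local Open Scope classical_set_scope.
Local Open Scope ring_scope.

(* The [n]-fold product of the one-dimensional Lebesgue measure; the factor
   of index 0 is the head of the tuple. *)
Fixpoint lebesgue_tuple (R : realType) (n : nat) :
    set (n.-tuple (measurableTypeR R)) -> \bar R :=
  match n with
  | 0 => fun A => \d_([tuple] : 0.-tuple (measurableTypeR R)) A
  | m.+1 => pushforward (lebesgue_measure \x @lebesgue_tuple R m)%E
      (fun p : measurableTypeR R * m.-tuple (measurableTypeR R) =>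
         [tuple of p.1 :: p.2])
  end.

(* The library has a measurable structure on tuples but none on ['rV[R]_n]. *)
Definition volume (R : realType) (n : nat) (A : set 'rV[R]_n) : \bar R :=
  lebesgue_tuple [set t | A (\row_i tnth t i)].

Section Polytopes.
Variables (R : realType) (n : nat).
Local Notation E := 'rV[R]_n.

Definition conv_hull (X : set E) : set E := smallest (@convex_set R E) X.

Definition convex_polytope (P : set E) : Prop :=
  exists X : {fset E}, P = conv_hull [set` X].

(* The vertices of a polytope are its extreme points. *)
Definition vertices (P : set E) : set E :=
  [set x | P x /\ forall (y z : E) (t : R), P y -> P z -> 0 < t < 1 ->
     x = t *: y + (1 - t) *: z -> y = x /\ z = x].

Definition affinely_independent (S : {fset E}) : Prop :=
  forall w : E -> R, \sum_(v <- S) w v = 0 -> \sum_(v <- S) w v *: v = 0 ->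
    forall v, v \in S -> w v = 0.

(* A non-degenerate [n]-dimensional simplex is given by its vertex set [S]; as
   a subset of R^n it is [conv_hull [set` S]]. *)
Definition simplex (S : {fset E}) : Prop :=
  #|` S| = n.+1 /\ affinely_independent S.

Definition full_dimensional (P : set E) : Prop :=
  exists S : {fset E}, simplex S /\ [set` S] `<=` P.

Definition hyperplane (u : E) (c : R) : set E :=
  [set x | \sum_(j < n) u ord0 j * x ord0 j = c].

Definition parallel_hyperplanes (H0 H1 : set E) : Prop :=
  exists (u : E) (c0 c1 : R),
    [/\ u != 0, H0 = hyperplane u c0 & H1 = hyperplane u c1].

Definition dissection (P : set E) (D : {fset {fset E}}) : Prop :=
  [/\ forall S, S \in D -> simplex S /\ [set` S] `<=` vertices P,
      trivIset [set` D] (fun S => (conv_hull [set` S])°)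
    & P = \bigcup_(S in [set` D]) conv_hull [set` S]].

Definition layer_volume (H0 : set E) (D : {fset {fset E}}) (i : nat) : \bar R :=
  (\sum_(S <- D | #|` [fset v in S | v \in H0]| == i)
     volume (conv_hull [set` S]))%E.

End Polytopes.

(* Main.v *)
Require Import Defs.
From HB Require Import structures.
From mathcomp Require Import all_boot all_order all_algebra.
From mathcomp Require Import finmap.
From mathcomp Require Import all_classical all_reals all_analysis.
From mathcomp Require Import measurable_realfun ring lra.

(** Let [h] be the affine function equal to 0 on [H0] and to 1 on [H1].  Affine
    maps multiply volumes by a constant, so every simplex with [k] vertices in
    [H0] satisfies [volume (T `&` [h <= s]) = c_T * g_k(s)], where [g_k(s)] is
    the volume of the part [y_k + ... + y_n <= s] of the standard simplex
    [y >= 0, y_1 + ... + y_n <= 1].  Summing over a dissection gives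
    [volume (P `&` [h <= s]) = \sum_k C_k * g_k(s)] with [C_k] the sum of [c_T]
    over the [k]-th layer.  Inscribed and circumscribed boxes show that [g_k(s)]
    is of exact order [s ^ (n + 1 - k)] as [s] tends to 0, so the functions
    [g_k] are linearly independent and the left-hand side, which does not depend on
    the dissection, determines all the [C_k], hence the layer volumes
    [C_k * g_k(1)]. *)

Set Implicit Arguments.
Unset Strict Implicit.
Unset Printing Implicit Defensive.

Import Order.TTheory GRing.Theory Num.Theory.
Import numFieldNormedType.Exports.

Local Open Scope classical_set_scope.
Local Open Scope ring_scope.

(** * Lebesgue measure on tuples *)

(** Lets an induction carry sigma-finiteness as an equality with a bundled measure, to which the
    product constructions apply. *)
Lemma sigma_finite_pack d (T : measurableType d) (R : realType)
    (m : {measure set T -> \bar R}) : sigma_finite setT m ->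
  exists mu : {sigma_finite_measure set T -> \bar R},
    (m : set T -> \bar R) = mu.
Proof.
move=> sf.
have sfin := sfinite_measure_sigma_finite sf.
pose mix1 := @isSFinite.Build _ _ _ m sfin.
pose mix2 := @isSigmaFinite.Build _ _ _ m sf.
pose mu := HB.pack_for (SigmaFiniteMeasure.type T R) (Measure.sort m) mix1 mix2.
by exists mu.
Qed.

Lemma dirac_sigma_finite d (T : measurableType d) (R : realType) (a : T) :
  sigma_finite setT (\d_a : set T -> \bar R).
Proof.
apply: fin_num_fun_sigma_finite; first by rewrite measure0.
exact: fin_num_measure.
Qed.

Section LebesgueTuple.
Variable R : realType.
Local Notation mR := (measurableTypeR R).
Local Notation leb := (@lebesgue_measure R).

Lemma measurable_consp n : measurable_fun setT
  (fun p : mR * n.-tuple mR => [tuple of p.1 :: p.2]).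
Proof. exact: measurable_cons. Qed.

(** Nondecreasing exhaustions [F] and [G] by sets of finite measure are multiplied index by index; a
    point with coordinates in [F i] and [G j] is reached at index [maxn i j]. *)
Lemma product_sigma_finite d1 d2 (T1 : measurableType d1)
    (T2 : measurableType d2) (m1 : {sigma_finite_measure set T1 -> \bar R})
    (m2 : {sigma_finite_measure set T2 -> \bar R}) :
  sigma_finite setT (m1 \x m2)%E.
Proof.
have /sigma_finiteP[F [FT Fnd Foo]] := sigma_finiteT m1.
have /sigma_finiteP[G [GT Gnd Goo]] := sigma_finiteT m2.
exists (fun n => F n `*` G n).
  apply/seteqP; split=> // -[x y] _.
  have : [set: T1] x by [].
  rewrite FT => -[i _ Fx].
  have : [set: T2] y by [].
  rewrite GT => -[j _ Gy].
  exists (maxn i j) => //; split=> /=.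
    by move/subsetPset: (Fnd _ _ (leq_maxl i j)); exact.
  by move/subsetPset: (Gnd _ _ (leq_maxr i j)); exact.
move=> n; have [mF Fy] := Foo n; have [mG Gy] := Goo n.
split; first exact: measurableX.
by rewrite product_measure1E// lte_mul_pinfty// ge0_fin_numE.
Qed.

(** The product construction relies on sigma-finiteness of the tail factor, so being a measure and
    being sigma-finite come out of one induction. *)
Lemma lebesgue_tuple_sigma_finite_measure n :
  {mu : {sigma_finite_measure set (n.-tuple mR) -> \bar R} |
    @lebesgue_tuple R n = mu}.
Proof.
apply: cid; elim: n => [|n [mu muE]].
  exact: (sigma_finite_pack (dirac_sigma_finite R ([tuple] : 0.-tuple mR))).
pose f (p : mR * n.-tuple mR) := [tuple of p.1 :: p.2].
have mf : measurable_fun setT f by exact: measurable_consp.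
pose g (t : n.+1.-tuple mR) := (thead t, [tuple of behead t]).
have mg : measurable_fun setT g.
  apply/measurable_fun_pairP; split => /=; last exact: measurable_behead.
  exact: measurable_tnth.
have gK t : f (g t) = t by rewrite [RHS]tuple_eta.
have fK p : g (f p) = p.
  by case: p => x t; rewrite /g /f /=; congr pair; exact/val_inj.
pose nu := pushforward (leb \x mu)%E f.
(* Prepending the head is a bijection with measurable inverse [g], along which the exhaustion of the
   product is pulled back. *)
have nu_sf : sigma_finite setT nu.
  have [F FT Foo] := product_sigma_finite leb mu.
  exists (fun n => g @^-1` F n).
    by rewrite -preimage_bigcup -FT preimage_setT.
  move=> k; have [mF Fy] := Foo k; split.
    by rewrite -[X in measurable X]setTI; exact: mg.
  rewrite /nu /pushforward (_ : _ @^-1` _ = F k)//.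
  by apply/seteqP; split=> p; rewrite /= fK.
rewrite /= muE; exact: (sigma_finite_pack nu_sf).
Qed.

Lemma lebesgue_tuple0 n : @lebesgue_tuple R n set0 = 0%E.
Proof.
by have [mu ->] := lebesgue_tuple_sigma_finite_measure n; exact: measure0.
Qed.

Lemma lebesgue_tuple_ge0 n A : (0 <= @lebesgue_tuple R n A)%E.
Proof.
by have [mu ->] := lebesgue_tuple_sigma_finite_measure n; exact: measure_ge0.
Qed.

Lemma lebesgue_tuple_semi_sigma_additive n :
  semi_sigma_additive (@lebesgue_tuple R n).
Proof.
have [mu ->] := lebesgue_tuple_sigma_finite_measure n.
exact: measure_semi_sigma_additive.
Qed.

HB.instance Definition _ n := isMeasure.Build _ _ _ (@lebesgue_tuple R n)
  (lebesgue_tuple0 n) (@lebesgue_tuple_ge0 n)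
  (@lebesgue_tuple_semi_sigma_additive n).

Lemma lebesgue_tuple_sigma_finite n : sigma_finite setT (@lebesgue_tuple R n).
Proof.
by have [mu ->] := lebesgue_tuple_sigma_finite_measure n; exact: sigma_finiteT.
Qed.

HB.instance Definition _ n := Measure_isSigmaFinite.Build _ _ _
  (@lebesgue_tuple R n) (lebesgue_tuple_sigma_finite n).

End LebesgueTuple.

(** * Sections of sets of row vectors *)

Definition row_of_tuple (R : realType) n (t : n.-tuple (measurableTypeR R)) :
  'rV[R]_n := \row_i tnth t i.

(** The dimension [1 + n] is convertible to [n.+1]; the block form makes the calculus of [row_mx]
    and [block_mx] applicable. *)
Definition cons_row (R : realType) n (x : R) (y : 'rV[R]_n) : 'rV[R]_n.+1 :=
  row_mx (x%:M : 'rV_1) y : 'rV_(1 + n).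

Definition vmeasurable (R : realType) n (A : set 'rV[R]_n) : Prop :=
  measurable (@row_of_tuple R n @^-1` A).

Section Volume.
Variable R : realType.
Local Notation mR := (measurableTypeR R).
Local Notation leb := (@lebesgue_measure R).

Lemma volumeE n (A : set 'rV[R]_n) :
  volume A = lebesgue_tuple (@row_of_tuple R n @^-1` A).
Proof. by []. Qed.

Lemma volume_ge0 n (A : set 'rV[R]_n) : (0 <= volume A)%E.
Proof. exact: measure_ge0. Qed.

Lemma cons_rowE n (x : R) (y : 'rV[R]_n) i : cons_row x y ord0 i =
  if unlift ord0 i is Some j then y ord0 j else x.
Proof.
case: unliftP => [j|] ->.
  have -> : lift ord0 j = rshift 1 j by exact/val_inj.
  exact: row_mxEr.
have -> : ord0 = lshift n (ord0 : 'I_1) by exact/val_inj.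
by rewrite [LHS]row_mxEl mxE eqxx.
Qed.

Lemma cons_rowD n (x b : R) (y c : 'rV[R]_n) :
  cons_row x y + cons_row b c = cons_row (x + b) (y + c).
Proof. by have := add_row_mx (x%:M : 'rV_1) y b%:M c; rewrite -raddfD. Qed.

Lemma cons_row_lsub_rsub n (y : 'rV[R]_n.+1) :
  y = cons_row (lsubmx (y : 'rV_(1 + n)) ord0 ord0) (rsubmx (y : 'rV_(1 + n))).
Proof. by rewrite /cons_row -mx11_scalar hsubmxK. Qed.

Lemma row_of_tuple_cons n (x : R) (t : n.-tuple mR) :
  row_of_tuple [tuple of x :: t] =
  cons_row x (row_of_tuple t).
Proof.
apply/rowP => i; rewrite cons_rowE mxE.
by case: unliftP => [j|] ->; rewrite ?tnthS ?mxE.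
Qed.

Lemma measurable_rV_preimage d (T : measurableType d) n (f : T -> 'rV[R]_n)
    (A : set 'rV[R]_n) :
  (forall i, measurable_fun setT (fun x => f x ord0 i : mR)) ->
  vmeasurable A -> measurable (f @^-1` A).
Proof.
move=> mf mA; pose g x := [tuple (f x ord0 i : mR) | i < n].
have gE x : row_of_tuple (g x) = f x.
  by apply/rowP => i; rewrite mxE tnth_mktuple.
have -> : f @^-1` A = g @^-1` (@row_of_tuple R n @^-1` A).
  by apply/seteqP; split => x; rewrite /= gE.
rewrite -[X in measurable X]setTI.
have: measurable_fun setT g.
  apply/measurable_fun_tnthP => i; rewrite (_ : _ \o _ = fun x => f x ord0 i)//.
  by apply/funext => x /=; rewrite tnth_mktuple.
by apply => //; exact: measurableT.
Qed.

Lemma measurable_fun_row n (i : 'I_n) :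
  measurable_fun setT (fun t : n.-tuple mR => row_of_tuple t ord0 i : mR).
Proof.
rewrite (_ : (fun _ => _) = @tnth n mR ^~ i); first exact: measurable_tnth.
by apply/funext => t; rewrite mxE.
Qed.

Lemma measurable_fun_mulmx d (T : measurableType d) n m (f : T -> 'rV[R]_n)
    (A : 'M[R]_(n, m)) (b : 'rV[R]_m) i :
  (forall i, measurable_fun setT (fun x => f x ord0 i : mR)) ->
  measurable_fun setT (fun x => (f x *m A + b) ord0 i : mR).
Proof.
move=> mf; under eq_fun do rewrite !mxE.
apply: measurable_funD => //; apply: measurable_sum => j.
apply: measurable_funM; [exact: mf|exact: measurable_cst].
Qed.

Lemma vmeasurable_affine n m (A : 'M[R]_(n, m)) (b : 'rV[R]_m)
    (X : set 'rV[R]_m) : vmeasurable X ->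
  vmeasurable [set y | X (y *m A + b)].
Proof.
apply: (measurable_rV_preimage (f := fun t => row_of_tuple t *m A + b)) => i.
apply: measurable_fun_mulmx => j; exact: measurable_fun_row.
Qed.

Lemma measurable_fun_row_mx d (T : measurableType d) n (f : T -> mR)
    (g : T -> 'rV[R]_n) :
  measurable_fun setT f ->
  (forall i, measurable_fun setT (fun x => g x ord0 i : mR)) ->
  forall i, measurable_fun setT
    (fun x => cons_row (f x : R) (g x) ord0 i : mR).
Proof.
by move=> mf mg i; under eq_fun do rewrite cons_rowE; case: (unlift ord0 i).
Qed.

Lemma volumeS n (A : set 'rV[R]_n.+1) :
  volume A = (\int[leb]_x
    volume [set y : 'rV_n | A (cons_row x y)])%E.
Proof.
rewrite volumeE /= /pushforward /product_measure1; apply: eq_integral => x _ /=.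
rewrite volumeE; congr (lebesgue_tuple _).
by apply/seteqP; split => t; rewrite /xsection /= inE /= row_of_tuple_cons.
Qed.

Lemma measurable_cons_preimage n (A : set 'rV[R]_n.+1) : vmeasurable A ->
  measurable
    [set p : mR * n.-tuple mR | A (cons_row (p.1 : R) (row_of_tuple p.2))].
Proof.
apply: (measurable_rV_preimage (f := fun p : mR * n.-tuple mR =>
  cons_row (p.1 : R) (row_of_tuple p.2))) => i.
apply: measurable_fun_row_mx => // j.
by apply: (measurableT_comp (@measurable_fun_row n j)).
Qed.

Lemma measurable_volume_section n (A : set 'rV[R]_n.+1) : vmeasurable A ->
  measurable_fun setT (fun x : mR => volume [set y : 'rV_n | A (cons_row x y)]).
Proof.
move=> /measurable_cons_preimage mB.
have := measurable_fun_xsection (@lebesgue_tuple R n) mB.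
congr measurable_fun; apply/funext => x /=; rewrite volumeE.
congr (lebesgue_tuple _).
by apply/seteqP; split => t; rewrite /xsection /= inE.
Qed.

Lemma measurable_lebesgue_section n (A : set 'rV[R]_n.+1) : vmeasurable A ->
  measurable_fun setT (fun t : n.-tuple mR =>
    leb [set x | A (cons_row x (row_of_tuple t))]).
Proof.
move=> /measurable_cons_preimage mB.
have := measurable_fun_ysection leb mB.
congr measurable_fun; apply/funext => t /=; congr (lebesgue_measure _).
by apply/seteqP; split => x; rewrite /ysection /= inE.
Qed.

(** The order of integration opposite to [volumeS]: the inner slices are lines parallel to the head
    axis. It serves for maps that move only the head coordinate. *)
Lemma volumeS_tonelli n (A : set 'rV[R]_n.+1) : vmeasurable A ->
  volume A = (\int[@lebesgue_tuple R n]_t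
    leb [set x | A (cons_row x (row_of_tuple t))])%E.
Proof.
move=> /measurable_cons_preimage mB.
have := indic_fubini_tonelli leb (@lebesgue_tuple R n) mB.
rewrite indic_fubini_tonelli_FE// indic_fubini_tonelli_GE// volumeS => e.
rewrite (eq_integral (@lebesgue_tuple R n \o xsection
    [set p : mR * n.-tuple mR | A (cons_row (p.1 : R) (row_of_tuple p.2))])).
  rewrite e; apply: eq_integral => t _ /=; congr (lebesgue_measure _).
  by apply/seteqP; split => x; rewrite /ysection /= inE.
move=> x _ /=; rewrite volumeE; congr (lebesgue_tuple _).
by apply/seteqP; split => t; rewrite /xsection /= inE.
Qed.

Lemma lebesgue_measure_affine (a b : R) (X : set mR) : a != 0 -> measurable X ->
  leb [set x | X (x * a + b)] = (`|a|^-1%:E * leb X)%E.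
Proof.
move=> a0 mX; pose f (x : mR) : mR := x * a + b.
have mf : measurable_fun setT f.
  by apply: measurable_funD => //; exact: measurable_funM.
have na : 0 < `|a| by rewrite normr_gt0.
(* By uniqueness of Lebesgue measure it suffices that the pushforward by [f], rescaled by [|a|],
   agrees with [leb] on half-open intervals. *)
have -> : leb X = (`|a|%:E * leb (f @^-1` X))%E.
  pose c : {nonneg R} := NngNum (ltW na).
  pose mu : {measure set mR -> \bar R} := mscale c (pushforward leb f).
  suff e : forall Y, ocitv Y -> leb Y = mu mf Y.
    exact: (lebesgue_measure_unique e mX).
  move=> _ [[p q]] _ <-.
  rewrite /mu /= /mscale /= /pushforward.
  have [a_gt0|a_lt0|a_eq0] := ltgtP 0 a; last by rewrite -a_eq0 eqxx in a0.
    have -> : f @^-1` `]p, q] = `](p - b) / a, (q - b) / a]%classic.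
      apply/seteqP; split => x /=; rewrite !in_itv /= /f;
        by rewrite ltr_pdivrMr// ler_pdivlMr// ltrBlDr lerBrDr.
    rewrite !lebesgue_measure_itv /= !lte_fin ltr_pM2r ?invr_gt0// ltrD2r.
    case: ifPn => _; last by rewrite mule0.
    rewrite -!EFinB -EFinM gtr0_norm//; congr EFin.
    by field.
  (* A negative slope reverses the interval and moves the closed end to the left, which leaves the
     length formula unchanged. *)
  have -> : f @^-1` `]p, q] = `[(q - b) / a, (p - b) / a[%classic.
    apply/seteqP; split => x /=; rewrite !in_itv /= /f;
      by rewrite ltr_ndivlMr// ler_ndivrMr// ltrBlDr lerBrDr andbC.
  rewrite !lebesgue_measure_itv /= !lte_fin ltr_nM2r ?invr_lt0// ltrD2r.
  case: ifPn => _; last by rewrite mule0.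
  rewrite -!EFinB -EFinM ltr0_norm//; congr EFin.
  by field.
by rewrite muleA -EFinM mulVf ?mul1e// gt_eqF.
Qed.
End Volume.

(** * Volume under affine maps *)

(** The set is a preimage, so for invertible [A] the factor is the inverse of |det A|. Only its
    existence is recorded: the argument compares coefficients without evaluating them. *)
Definition scales_volume (R : realType) n (A : 'M[R]_n) : Prop :=
  exists2 c : R, 0 <= c & forall X : set 'rV[R]_n, vmeasurable X ->
    volume [set y | X (y *m A)] = (c%:E * volume X)%E.

Section VolumeAffine.
Variable R : realType.
Local Notation mR := (measurableTypeR R).
Local Notation leb := (@lebesgue_measure R).

Lemma vmeasurable_section n (A : set 'rV[R]_n.+1) (x : R) : vmeasurable A ->
  vmeasurable [set y : 'rV_n | A (cons_row x y)].
Proof.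
apply: (measurable_rV_preimage (f := fun t : n.-tuple mR =>
  cons_row x (row_of_tuple t))).
apply: measurable_fun_row_mx => //; exact: measurable_fun_row.
Qed.

Lemma measurable_section n (A : set 'rV[R]_n.+1) (y : 'rV[R]_n) :
  vmeasurable A ->
  measurable [set x : mR | A (cons_row x y)].
Proof.
apply: (measurable_rV_preimage (f := fun x : mR =>
  cons_row x y)).
exact: measurable_fun_row_mx.
Qed.

Lemma vmeasurable_translate n (b : 'rV[R]_n) (X : set 'rV[R]_n) :
  vmeasurable X -> vmeasurable [set y | X (y + b)].
Proof. by move/(vmeasurable_affine 1%:M b); under eq_set do rewrite mulmx1. Qed.

Lemma vmeasurable_mulmx n m (A : 'M[R]_(n, m)) (X : set 'rV[R]_m) :
  vmeasurable X -> vmeasurable [set y | X (y *m A)].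
Proof. by move/(vmeasurable_affine A 0); under eq_set do rewrite addr0. Qed.

(** The tail part of the translation is the induction hypothesis on sections at fixed head; the head
    part is the one-dimensional case under Tonelli. *)
Lemma volume_translate n (b : 'rV[R]_n) (X : set 'rV[R]_n) :
  vmeasurable X -> volume [set y | X (y + b)] = volume X.
Proof.
elim: n b X => [|n IH] b X mX.
  congr volume; apply/seteqP; split => y /=;
    by rewrite [y + b]thinmx0 [y]thinmx0.
rewrite [b]cons_row_lsub_rsub; set b0 := lsubmx _ _ _; set bn := rsubmx _.
transitivity (volume [set y : 'rV_n.+1 | X (y + cons_row b0 (0 : 'rV_n))]).
  rewrite !volumeS; apply: eq_integral => x _.
  have mY := vmeasurable_section (x + b0) mX.
  rewrite -[in RHS](IH bn) //.
    by congr volume; apply/seteqP; split => y /=; rewrite !cons_rowD addr0.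
  have := vmeasurable_section x
    (vmeasurable_translate (cons_row b0 (0 : 'rV_n)) mX).
  exact.
rewrite !volumeS_tonelli//; last exact: vmeasurable_translate.
apply: eq_integral => t _.
have mY := measurable_section (row_of_tuple t) mX.
have := lebesgue_measure_affine b0 (oner_neq0 R) mY.
rewrite normr1 invr1 mul1e => <-; congr (lebesgue_measure _).
apply/seteqP; split => x /=;
  by rewrite cons_rowD addr0 mulr1.
Qed.

Lemma cons_row_mul_head n (x a : R) (y : 'rV[R]_n) (w : 'cV[R]_n) :
  cons_row x y *m (block_mx (a%:M : 'M[R]_1) 0 w 1%:M : 'M[R]_(1 + n)) =
  cons_row (x * a + (y *m w) ord0 ord0) y.
Proof.
have := mul_row_block (x%:M : 'rV_1) y a%:M 0 w 1%:M.
rewrite mulmx0 add0r mulmx1 -scalar_mxM {1}[y *m w]mx11_scalar.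
by rewrite -raddfD.
Qed.

Lemma cons_row_mul_tail n (x : R) (y l : 'rV[R]_n) (B : 'M[R]_n) :
  cons_row x y *m (block_mx (1%:M : 'M[R]_1) l 0 B : 'M[R]_(1 + n)) =
  cons_row x (y *m B + x *: l).
Proof.
have := mul_row_block (x%:M : 'rV_1) y 1%:M l 0 B.
by rewrite mulmx0 addr0 mulmx1 mul_scalar_mx [_ + y *m B]addrC.
Qed.

Lemma scales_volume_mul n (A B : 'M[R]_n) :
  scales_volume A -> scales_volume B -> scales_volume (A *m B).
Proof.
move=> [c c0 cA] [d d0 dB]; exists (c * d); first exact: mulr_ge0.
move=> X mX; rewrite EFinM -muleA -dB// -cA; last exact: vmeasurable_mulmx.
by congr volume; apply/seteqP; split => y /=; rewrite mulmxA.
Qed.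

(** Each line parallel to the head axis is mapped to itself by an affine map of slope [a], with an
    offset depending only on the tail. *)
Lemma scales_volume_head n (a : R) (w : 'cV[R]_n) : a != 0 ->
  @scales_volume R n.+1 (block_mx (a%:M : 'M[R]_1) 0 w 1%:M : 'M[R]_(1 + n)).
Proof.
move=> a0; exists `|a|^-1 => [|X mX]; first by rewrite invr_ge0.
rewrite !volumeS_tonelli//; last exact: vmeasurable_mulmx.
rewrite -ge0_integralZl//; last exact: measurable_lebesgue_section.
apply: eq_integral => t _.
have mY := measurable_section (row_of_tuple t) mX.
rewrite -(lebesgue_measure_affine ((row_of_tuple t *m w) ord0 ord0) a0 mY).
congr (lebesgue_measure _); apply/seteqP; split => x /=;
  by rewrite cons_row_mul_head.
Qed.

(** Each section at fixed head [x] is mapped to itself by [B] followed by the translation by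
    [x *: l]. *)
Lemma scales_volume_tail n (l : 'rV[R]_n) (B : 'M[R]_n) : scales_volume B ->
  @scales_volume R n.+1 (block_mx (1%:M : 'M[R]_1) l 0 B : 'M[R]_(1 + n)).
Proof.
move=> [c c0 cB]; exists c => // X mX.
rewrite !volumeS -ge0_integralZl//; last exact: measurable_volume_section.
apply: eq_integral => x _.
have mY := vmeasurable_section x mX.
rewrite -(volume_translate (x *: l) mY) -cB; last exact: vmeasurable_translate.
congr volume; apply/seteqP; split => y /=;
  by rewrite cons_row_mul_tail.
Qed.

(* The head and tail shears generate the general linear group: a nonzero pivot
   is split off by a Schur complement, and a zero pivot is first made nonzero
   by a tail shear. *)
Lemma scales_volume_unitmx n (A : 'M[R]_n) : A \in unitmx -> scales_volume A.
Proof.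
elim: n A => [|n IH] A uA.
  exists 1 => // X mX; rewrite mul1e; congr volume.
  by apply/seteqP; split => y /=; rewrite [y *m A]thinmx0 [y]thinmx0.
have pivot (M : 'M[R]_(1 + n)) : M \in unitmx -> ulsubmx M ord0 ord0 != 0 ->
    @scales_volume R n.+1 M.
  move=> uM; set a := ulsubmx M ord0 ord0 => a0.
  have ME : M = block_mx (a%:M : 'M[R]_1) 0 (dlsubmx M) 1%:M *m
     block_mx 1%:M (a^-1 *: ursubmx M) 0
       (drsubmx M - dlsubmx M *m (a^-1 *: ursubmx M)).
    rewrite mulmx_block !mulmx1 !mulmx0 !mul0mx !addr0 ?mul1mx.
    rewrite mul_scalar_mx scalerA mulfV// scale1r addrC subrK.
    by rewrite -mx11_scalar submxK.
  have uB : drsubmx M - dlsubmx M *m (a^-1 *: ursubmx M) \in unitmx.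
    move: uM; rewrite [X in X \in _ -> _]ME unitmx_mul => /andP[_].
    by rewrite unitmxE det_ublock det1 mul1r -unitmxE.
  rewrite ME; apply: scales_volume_mul; first exact: scales_volume_head.
  exact/scales_volume_tail/IH.
pose A' : 'M[R]_(1 + n) := A.
have uA' : A' \in unitmx by [].
have [a0|] := eqVneq (ulsubmx A' ord0 ord0) 0; last exact: pivot.
pose w := dlsubmx A'.
have w0 : w != 0.
  apply/eqP => w0; move: uA'; rewrite -[A']submxK [ulsubmx A']mx11_scalar a0.
  rewrite -/w w0 (_ : 0%:M = 0); last by rewrite raddf0.
  by rewrite unitmxE det_ublock det0 mul0r unitr0.
(* Shearing by the transpose of the first column's lower part [w] replaces the zero pivot by the sum
   of squares of the entries of [w], which is nonzero. *)
pose U (l : 'rV[R]_n) : 'M[R]_(1 + n) := block_mx 1%:M l 0 1%:M.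
have UK : A' = U (- w^T) *m (U w^T *m A').
  rewrite mulmxA /U mulmx_block !mulmx1 !mul1mx !mulmx0 !mul0mx !addr0 !add0r.
  by rewrite subrr -scalar_mx_block mul1mx.
have uU l : U l \in unitmx by rewrite unitmxE det_ublock !det1 mulr1 unitr1.
rewrite -[A]/A' UK; apply: scales_volume_mul.
  by apply: scales_volume_tail; apply: IH; exact: unitmx1.
apply: pivot; first by rewrite unitmx_mul uU.
rewrite -[A']submxK /U mulmx_block block_mxKul mul1mx mxE a0 add0r -/w.
rewrite mxE; under eq_bigr do rewrite mxE -expr2.
rewrite psumr_eq0 => [|i _]; last exact: sqr_ge0.
apply/negP => /allP w2; case/negP: w0; apply/eqP/colP => i.
move: (w2 i (mem_index_enum _)) => /=; rewrite sqrf_eq0 => /eqP ->.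
by rewrite mxE.
Qed.

Lemma volume_affine n (A : 'M[R]_n) : A \in unitmx ->
  exists2 c : R, 0 <= c & forall (b : 'rV[R]_n) (X : set 'rV[R]_n),
    vmeasurable X -> volume [set y | X (y *m A + b)] = (c%:E * volume X)%E.
Proof.
move=> /scales_volume_unitmx[c c0 cA]; exists c => // b X mX.
rewrite (cA [set y | X (y + b)]) ?volume_translate//.
exact: vmeasurable_translate.
Qed.
End VolumeAffine.

(** * Simplices in barycentric coordinates *)

Section Simplices.
Variables (R : realType) (n : nat).
Local Notation E := 'rV[R]_n.

Lemma convex_setP (A : set E) : convex_set A <->
  forall x y (t : R), A x -> A y -> 0 <= t <= 1 -> A (t *: x + (1 - t) *: y).
Proof.
split => [cA x y t Ax Ay t01|cA x y l /[!inE] Ax Ay].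
  have := cA x y (Itv01 (andP t01).1 (andP t01).2).
  by rewrite !inE; exact.
by apply: cA => //; apply/andP; split.
Qed.

(** Induction on the number of points: the first [m] weights are renormalised by their sum [q], and
    the last point carries [1 - q]. If [q] is 0, all the other terms vanish. *)
Lemma convex_set_sum (A : set E) (m : nat) (p : 'I_m -> R) (x : 'I_m -> E) :
  convex_set A -> (forall i, 0 <= p i) -> (forall i, A (x i)) ->
  \sum_i p i = 1 -> A (\sum_i p i *: x i).
Proof.
move=> /convex_setP cA; elim: m p x => [|m IH] p x p0 Ax p1.
  by move/eqP: p1; rewrite big_ord0 eq_sym oner_eq0.
move: p1; rewrite !big_ord_recr /=; set q := \sum_(i < m) _ => p1.
have q0 : 0 <= q by apply: sumr_ge0.
have pE : p ord_max = 1 - q by rewrite -p1 [q + _]addrC addrK.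
have [q_eq0|q_neq0] := eqVneq q 0.
  rewrite pE q_eq0 subr0 scale1r big1 ?add0r// => i _.
  have : \sum_(i < m) p (widen_ord (leqnSn m) i) == 0 by rewrite -/q q_eq0.
  rewrite psumr_eq0// => /allP/(_ i (mem_index_enum _))/eqP/= ->.
  by rewrite scale0r.
rewrite pE (_ : \sum_(i < m) _ = q *: \sum_(i < m)
    ((p (widen_ord (leqnSn m) i) / q) *: x (widen_ord (leqnSn m) i))).
  apply: cA => //; last by rewrite q0/= -subr_ge0 -pE.
  apply: IH => // [i|]; first by rewrite divr_ge0.
  by rewrite -mulr_suml mulfV.
rewrite scaler_sumr; apply: eq_bigr => i _.
by rewrite scalerA mulrCA mulfV ?mulr1.
Qed.

(** The rows are the edges from the first vertex, so [y *m edge_mx s] plus that vertex parametrises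
    the simplex by the standard one. *)
Definition edge_mx (s : seq E) : 'M[R]_n := \matrix_(j < n) (s`_j.+1 - s`_0).

Definition std_simplex : set E :=
  [set y | (forall j, 0 <= y ord0 j) /\ \sum_j y ord0 j <= 1].

Definition open_std_simplex : set E :=
  [set y | (forall j, 0 < y ord0 j) /\ \sum_j y ord0 j < 1].

Lemma edge_mx_unit (S : {fset E}) (s : seq E) :
  perm_eq s S -> simplex S -> edge_mx s \in unitmx.
Proof.
move=> sS [cS iS].
have ss : size s = n.+1 by rewrite (perm_size sS).
have us : uniq s by rewrite (perm_uniq sS) fset_uniq.
rewrite -row_free_unit; apply: inj_row_free => w wM.
(* A linear relation [w] among the edges becomes an affine relation among the vertices: vertex 0
   receives minus the sum of [w], so that the weights add up to 0. *)
pose f j : R :=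
  if j is j'.+1 then oapp (w ord0) 0 (insub j') else - \sum_j w ord0 j.
have fS (j : 'I_n) : f j.+1 = w ord0 j by rewrite /f /= valK.
have sumE (V : lmodType R) (F : nat -> V) :
  \sum_(j < n.+1) f j *: F j = \sum_(j < n) w ord0 j *: (F j.+1 - F 0).
  rewrite big_ord_recl /= scaleNr scaler_suml.
  under [RHS]eq_bigr do rewrite scalerBr.
  rewrite sumrB addrC; congr (_ - _); apply: eq_bigr => j _.
  by rewrite -fS.
have idx j : (j < n.+1)%N -> index s`_j s = j.
  by move=> jn; rewrite index_uniq ?ss.
(* Used twice: with [F] constant 1 for the sum of the weights, and with [F] the identity for the
   weighted sum of the vertices. *)
have sumS (V : lmodType R) (F : E -> V) :
    \sum_(v <- S) f (index v s) *: F v =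
    \sum_(j < n) w ord0 j *: (F s`_j.+1 - F s`_0).
  rewrite -(perm_big _ sS)/= (big_nth 0) big_mkord ss.
  rewrite -(sumE _ (fun j => F s`_j)).
  by apply: eq_bigr => j _; rewrite idx.
apply/rowP => j; rewrite mxE -fS -(idx j.+1) ?ltnS//.
apply: (iS (fun v => f (index v s))).
- have := sumS R^o (fun=> 1).
  under eq_bigr do rewrite [_ *: _]mulr1.
  move=> ->; rewrite big1 // => i _; by rewrite subrr scaler0.
- rewrite (sumS E id) -[RHS]wM mulmx_sum_row; apply: eq_bigr => i _.
  by rewrite rowK.
- by rewrite -(perm_mem sS) mem_nth // ss ltnS.
Qed.

(** The chart sends vertex 0 to the origin and the others to the unit vectors. The right-hand side
    is convex and contains the vertices, hence contains the hull; conversely its points are convex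
    combinations of the vertices. *)
Lemma conv_hull_simplexE (S : {fset E}) (s : seq E) :
  perm_eq s S -> simplex S ->
  conv_hull [set` S] = [set x | std_simplex ((x - s`_0) *m invmx (edge_mx s))].
Proof.
move=> sS simS; have uM := edge_mx_unit sS simS.
have ss : size s = n.+1 by rewrite (perm_size sS) simS.1.
set M := edge_mx s in uM *.
have sA j : (j < n.+1)%N -> [set` S] s`_j.
  by move=> jn; rewrite /= -(perm_mem sS) mem_nth // ss.
apply/seteqP; split.
  apply: smallest_sub.
    apply/convex_setP => x y t [x0 x1] [y0 y1] /andP[t0 t1].
    have t1' : 0 <= 1 - t by rewrite subr_ge0.
    rewrite /mkset; have -> : (t *: x + (1 - t) *: y - s`_0) *m invmx M =
        t *: ((x - s`_0) *m invmx M) + (1 - t) *: ((y - s`_0) *m invmx M).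
      rewrite !scalemxAl -mulmxDl; congr (_ *m _).
      rewrite !scalerBr addrACA -opprD -scalerDl.
      by rewrite (addrC t) subrK scale1r.
    split => [j|].
      rewrite mxE [X in _ <= X + _]mxE [X in _ <= _ + X]mxE.
      by rewrite addr_ge0 // mulr_ge0.
    under eq_bigr do rewrite mxE [X in X + _]mxE [X in _ + X]mxE.
    rewrite big_split -!mulr_sumr /=.
    apply: (@le_trans _ _ (t * 1 + (1 - t) * 1)).
      by rewrite lerD// ler_wpM2l.
    by rewrite !mulr1 addrC subrK.
  move=> v /= vS; have : v \in s by rewrite (perm_mem sS).
  move=> /(nthP 0)[[|j]]; rewrite ss ltnS => jn <-.
    rewrite subrr mul0mx; split => [i|]; first by rewrite mxE.
    by rewrite big1 ?ler01// => i _; rewrite mxE.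
  pose jj := Ordinal jn.
  have -> : s`_j.+1 - s`_0 = delta_mx ord0 jj *m M.
    by rewrite -rowE rowK.
  rewrite mulmxK//; split => [i|]; first by rewrite mxE ler0n.
  rewrite (bigD1 jj)//= big1 => [|i /negPf ij]; rewrite mxE ?eqxx ?addr0//.
  by rewrite ij andbF.
move=> x [y0 y1]; set y := (x - s`_0) *m invmx M in y0 y1.
have yM : y *m M = x - s`_0 by rewrite mulmxKV.
(* The barycentric weights: vertex 0 takes what the chart coordinates leave up to 1. *)
pose p (j : 'I_n.+1) : R := oapp (y ord0) (1 - \sum_j y ord0 j) (unlift ord0 j).
have xE : x = \sum_(j < n.+1) p j *: s`_j.
  rewrite big_ord_recl /p unlift_none /=.
  under [X in _ + X]eq_bigr do rewrite liftK /=.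
  rewrite scalerBl scale1r scaler_suml -addrA -[LHS](subrK s`_0) addrC -yM.
  congr (_ + _); rewrite mulmx_sum_row addrC -sumrB; apply: eq_bigr => j _.
  by rewrite rowK scalerBr.
move=> A [cA SA]; rewrite xE; apply: convex_set_sum => // [j|j|].
- rewrite /p; case: unliftP => [i|] _ /=; first exact: y0.
  by rewrite subr_ge0.
- exact/SA/sA.
- rewrite big_ord_recl /p unlift_none /=.
  under [X in _ + X]eq_bigr do rewrite liftK /=.
  by rewrite subrK.
Qed.
End Simplices.

(** * Boxes, slabs and hyperplanes *)

Section Slabs.
Variable R : realType.
Local Notation mR := (measurableTypeR R).
Local Notation leb := (@lebesgue_measure R).

Lemma vmeasurableI n (A B : set 'rV[R]_n) :
  vmeasurable A -> vmeasurable B -> vmeasurable (A `&` B).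
Proof. exact: measurableI. Qed.

Lemma vmeasurableD n (A B : set 'rV[R]_n) :
  vmeasurable A -> vmeasurable B -> vmeasurable (A `\` B).
Proof. exact: measurableD. Qed.

Lemma vmeasurable_forall n (I : finType) (A : I -> set 'rV[R]_n) :
  (forall i, vmeasurable (A i)) -> vmeasurable [set y | forall i, A i y].
Proof.
move=> mA; rewrite /vmeasurable.
rewrite (_ : _ @^-1` _ = \bigcap_i (@row_of_tuple R n @^-1` A i)).
  by apply: fin_bigcap_measurable => [|i _]; [exact: finite_finset|exact: mA].
by apply/seteqP; split => t /= At i; [move=> _; exact: At|exact: At].
Qed.

Lemma vmeasurable_le n (f g : 'rV[R]_n -> R) :
  measurable_fun setT (f \o @row_of_tuple R n) ->
  measurable_fun setT (g \o @row_of_tuple R n) ->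
  vmeasurable [set y | f y <= g y].
Proof.
move=> mf mg.
have := measurable_fun_ler mf mg => /(_ measurableT [set true]).
by rewrite setTI; apply.
Qed.

Lemma vmeasurable_lt n (f g : 'rV[R]_n -> R) :
  measurable_fun setT (f \o @row_of_tuple R n) ->
  measurable_fun setT (g \o @row_of_tuple R n) ->
  vmeasurable [set y | f y < g y].
Proof.
move=> mf mg.
have := measurable_fun_ltr mf mg => /(_ measurableT [set true]).
by rewrite setTI; apply.
Qed.

Lemma measurable_coord n (i : 'I_n) :
  measurable_fun setT ((fun y : 'rV[R]_n => y ord0 i) \o @row_of_tuple R n).
Proof. exact: measurable_fun_row. Qed.

Lemma measurable_lin n (u : 'rV[R]_n) :
  measurable_fun setT
    ((fun y => \sum_j u ord0 j * y ord0 j) \o @row_of_tuple R n).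
Proof.
apply: measurable_sum => j; apply: measurable_funM; first exact: measurable_cst.
exact: measurable_fun_row.
Qed.

Lemma measurable_sum_coord n (P : pred 'I_n) : measurable_fun setT
  ((fun y : 'rV[R]_n => \sum_(j | P j) y ord0 j) \o @row_of_tuple R n).
Proof.
rewrite (_ : _ \o _ = fun t =>
    \sum_j (if P j then row_of_tuple t ord0 j else 0)).
  by apply: measurable_sum => j; case: (P j) => //; exact: measurable_fun_row.
by apply/funext => t; rewrite /= big_mkcond.
Qed.

Lemma vmeasurable_coord_ge n (i : 'I_n) (c : R) :
  vmeasurable [set y | c <= y ord0 i].
Proof.
apply: (vmeasurable_le (f := fun=> c) (g := fun y => y ord0 i)).
  exact: measurable_cst.
exact: measurable_coord.
Qed.

Lemma vmeasurable_coord_le n (i : 'I_n) (c : R) :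
  vmeasurable [set y | y ord0 i <= c].
Proof.
apply: (vmeasurable_le (f := fun y => y ord0 i) (g := fun=> c)).
  exact: measurable_coord.
exact: measurable_cst.
Qed.

Lemma vmeasurable_coord_gt n (i : 'I_n) (c : R) :
  vmeasurable [set y | c < y ord0 i].
Proof.
apply: (vmeasurable_lt (f := fun=> c) (g := fun y => y ord0 i)).
  exact: measurable_cst.
exact: measurable_coord.
Qed.

Lemma vmeasurable_sum_le n (P : pred 'I_n) (c : R) :
  vmeasurable [set y | \sum_(j | P j) y ord0 j <= c].
Proof.
apply: (vmeasurable_le (f := fun y => \sum_(j | P j) y ord0 j) (g := fun=> c)).
  exact: measurable_sum_coord.
exact: measurable_cst.
Qed.

Lemma vmeasurable_sum_lt n (P : pred 'I_n) (c : R) :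
  vmeasurable [set y | \sum_(j | P j) y ord0 j < c].
Proof.
apply: (vmeasurable_lt (f := fun y => \sum_(j | P j) y ord0 j) (g := fun=> c)).
  exact: measurable_sum_coord.
exact: measurable_cst.
Qed.

Definition box n (c : 'I_n -> R) : set 'rV[R]_n :=
  [set y | forall j, 0 <= y ord0 j <= c j].

Lemma vmeasurable_box n (c : 'I_n -> R) : vmeasurable (box c).
Proof.
apply: (vmeasurable_forall (A := fun j y => 0 <= y ord0 j <= c j)) => j.
have := vmeasurableI (vmeasurable_coord_ge j 0) (vmeasurable_coord_le j (c j)).
by congr vmeasurable; apply/seteqP; split => y /= /andP.
Qed.

Lemma volume_box n (c : 'I_n -> R) : (forall j, 0 <= c j) ->
  volume (box c) = (\prod_j c j)%:E.
Proof.
elim: n c => [|n IH] c c0.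
  rewrite big_ord0 volumeE /= diracE mem_set//; by case.
pose c' j := c (lift ord0 j).
rewrite volumeS big_ord_recl mulrC EFinM -IH//.
transitivity (\int[leb]_x
    (volume (box c') * (\1_(`[0, c ord0] : set mR) x)%:E)%E)%E.
  apply: eq_integral => x _; rewrite indicE.
  have [xc|xc] := boolP (0 <= x <= c ord0); last first.
    rewrite memNset /= ?in_itv; last exact/negP.
    rewrite mule0 volumeE (_ : _ @^-1` _ = set0)// -subset0 => t /= /(_ ord0).
    by rewrite cons_rowE unlift_none; exact/negP.
  rewrite mem_set /= ?in_itv//.
  rewrite mule1; congr volume; apply/seteqP; split => y /= yc j.
    by have := yc (lift ord0 j); rewrite cons_rowE liftK.
  by rewrite cons_rowE; case: unliftP => [i|] ->.
rewrite ge0_integralZl//; last first.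
  exact/measurable_EFinP/measurable_indic.
rewrite integral_indic// setIT /= lebesgue_measure_itv /= lte_fin.
congr (_ * _)%E; have [_|c_lt0|<-] := ltgtP 0 (c ord0) => //=.
  by rewrite sube0.
by have := c0 ord0; rewrite leNgt c_lt0.
Qed.

Lemma le_volume n (A B : set 'rV[R]_n) : vmeasurable A -> vmeasurable B ->
  A `<=` B -> (volume A <= volume B)%E.
Proof.
by move=> mA mB AB; rewrite !volumeE le_measure ?inE//; move=> t; exact: AB.
Qed.

(* Coordinate [j] is the weight of the vertex of index [j.+1], the weight of
   vertex 0 being the complement of the sum to 1; the vertices of index below
   [k] are those in [H0]. *)
Definition slab n (k : nat) (s : R) : set 'rV[R]_n :=
  std_simplex (R := R) (n := n) `&` 
  [set y | \sum_(j < n | (k <= j.+1)%N) y ord0 j <= s].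

Lemma vmeasurable_std_simplex n : vmeasurable (@std_simplex R n).
Proof.
apply: vmeasurableI.
  by apply: vmeasurable_forall => j; exact: vmeasurable_coord_ge.
exact: vmeasurable_sum_le.
Qed.

Lemma vmeasurable_open_std_simplex n : vmeasurable (@open_std_simplex R n).
Proof.
apply: vmeasurableI.
  by apply: vmeasurable_forall => j; exact: vmeasurable_coord_gt.
exact: vmeasurable_sum_lt.
Qed.

Lemma vmeasurable_slab n k s : vmeasurable (@slab n k s).
Proof.
apply: vmeasurableI; first exact: vmeasurable_std_simplex.
exact: vmeasurable_sum_le.
Qed.

(** For [0 < k], exactly [n.+1 - k] of the indices [j < n] satisfy [k <= j.+1], with truncated
    subtraction giving 0 beyond [n.+1]. *)
Lemma prod_slab_sides n k (s : R) : (0 < k)%N ->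
  \prod_(j < n) (if (k <= j.+1)%N then s else 1) = s ^+ (n.+1 - k).
Proof.
move=> k0; elim: n => [|n IH].
  by rewrite big_ord0 (_ : 1 - k = 0)%N//; apply/eqP; rewrite subn_eq0.
rewrite big_ord_recr /= IH; case: leqP => kn.
  by rewrite -exprSr [in RHS]subSn.
have -> : (n.+1 - k = 0)%N by apply/eqP; rewrite subn_eq0 ltnW.
by rewrite mulr1 (_ : n.+2 - k = 0)%N//; apply/eqP; rewrite subn_eq0.
Qed.

Lemma coord_le_sum n (y : 'rV[R]_n) (P : pred 'I_n) j :
  (forall i, 0 <= y ord0 i) -> P j -> y ord0 j <= \sum_(i | P i) y ord0 i.
Proof. by move=> y0 Pj; rewrite (bigD1 j)//= lerDl sumr_ge0. Qed.

(** Circumscribed box: a nonnegative coordinate is at most any sum containing it, so the sides are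
    [s] for indices with [k <= j.+1] and 1 for the others. *)
Lemma volume_slab_le n k s : (0 < k)%N -> 0 <= s ->
  (volume (@slab n k s) <= (s ^+ (n.+1 - k))%:E)%E.
Proof.
move=> k0 s0; rewrite -prod_slab_sides// -volume_box => [|j]; last by case: ifP.
apply: le_volume; [exact: vmeasurable_slab|exact: vmeasurable_box|].
move=> y [[y0 y1] ys] j; rewrite y0/=; case: ifP => kj.
  exact: le_trans (coord_le_sum y0 kj) ys.
exact: le_trans (coord_le_sum (P := xpredT) y0 _) y1.
Qed.

(** Inscribed box: the sides of the circumscribed box are divided by [n.+1], so that a sum of at
    most [n] coordinates stays within the bound. This produces the factor [n.+1%:R ^- n]. *)
Lemma volume_slab_ge n k s : (0 < k)%N -> 0 <= s <= 1 ->
  ((n.+1%:R ^- n * s ^+ (n.+1 - k))%:E <= volume (@slab n k s))%E.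
Proof.
move=> k0 /andP[s0 s1]; rewrite -prod_slab_sides//.
have e : n.+1%:R ^- n = \prod_(j < n) (n.+1%:R^-1 : R).
  by rewrite prodr_const card_ord exprVn.
have i0 : 0 <= (n.+1%:R^-1 : R) by rewrite invr_ge0 ler0n.
have i1 : n%:R * (n.+1%:R^-1 : R) <= 1.
  by rewrite ler_pdivrMr ?ltr0n// mul1r ler_nat.
rewrite e -big_split /= -volume_box => [|j]; last first.
  by rewrite mulr_ge0//; case: ifP.
apply: le_volume; [exact: vmeasurable_box|exact: vmeasurable_slab|].
move=> y yb.
have y0 j : 0 <= y ord0 j by have /andP[] := yb j.
have sumc (P : pred 'I_n) (c : R) : 0 <= c ->
    (forall j, P j -> y ord0 j <= n.+1%:R^-1 * c) ->
    \sum_(j | P j) y ord0 j <= c.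
  move=> c0 yc; apply: (@le_trans _ _ (\sum_(j < n) n.+1%:R^-1 * c)).
    rewrite big_mkcond; apply: ler_sum => j _; case: ifPn => // Pj.
      exact: yc.
    by rewrite mulr_ge0.
  rewrite sumr_const card_ord -[leLHS]mulr_natl mulrA.
  by rewrite -[leRHS]mul1r ler_wpM2r.
split; [split => //|].
  apply: sumc => // j _; have /andP[_ /le_trans->]// := yb j.
  by rewrite ler_wpM2l//; case: ifP.
by apply: sumc => // j kj; have := yb j; rewrite kj => /andP[].
Qed.

Lemma vmeasurable_hyperplane n (u : 'rV[R]_n) (c : R) :
  vmeasurable (hyperplane u c).
Proof.
pose f (y : 'rV[R]_n) := \sum_(j < n) u ord0 j * y ord0 j.
have mf : measurable_fun setT (f \o @row_of_tuple R n) by exact: measurable_lin.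
have mc : measurable_fun setT ((fun=> c) \o @row_of_tuple R n).
  exact: measurable_cst.
have := vmeasurableI (vmeasurable_le mf mc) (vmeasurable_le mc mf).
congr vmeasurable; apply/seteqP; split => y /= => [[yc cy]|].
  by apply/eqP; rewrite eq_le yc.
by rewrite /hyperplane /= -/(f y) => ->.
Qed.

(** If the head coefficient [a] is 0, the sections at fixed head are hyperplanes of lower dimension.
    Otherwise each line parallel to the head axis meets the hyperplane in one point, and Tonelli
    applies. *)
Lemma volume_hyperplane n (u : 'rV[R]_n) (c : R) : u != 0 ->
  volume (hyperplane u c) = 0%E.
Proof.
elim: n u => [|n IH] u u0; first by rewrite [u]thinmx0 eqxx in u0.
move: u0; rewrite [u]cons_row_lsub_rsub.
set a := lsubmx _ _ _; set w := rsubmx _.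
have HE x y : hyperplane (cons_row a w) c (cons_row x y) <->
    a * x + \sum_(j < n) w ord0 j * y ord0 j = c.
  rewrite /hyperplane /= big_ord_recl !cons_rowE !unlift_none.
  rewrite (eq_bigr (fun j => w ord0 j * y ord0 j))// => j _.
  by rewrite !cons_rowE !liftK.
have [a0|a0] := eqVneq a 0.
  move=> u0; have w0 : w != 0.
    apply: contraNneq u0 => w0; apply/eqP/rowP => i; rewrite cons_rowE mxE.
    by case: unlift => [j|]; rewrite ?w0 ?mxE.
  rewrite volumeS integral0_eq// => x _; rewrite -(IH _ w0); congr volume.
  apply/seteqP; split => y /=; rewrite (HE x y) a0 mul0r add0r//.
move=> _; rewrite volumeS_tonelli; last exact: vmeasurable_hyperplane.
rewrite integral0_eq// => t _.
rewrite (_ : [set x | _] =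
    [set (c - \sum_(j < n) w ord0 j * row_of_tuple t ord0 j) / a]).
  exact: lebesgue_measure_set1.
apply/seteqP; split => x /=; rewrite (HE x (row_of_tuple t)).
  by move=> <-; rewrite addrK mulrAC mulfV ?mul1r.
by move=> ->; rewrite mulrC mulfVK// subrK.
Qed.
End Slabs.

(** * Charts of simplices *)

(** Subadditivity gives one inequality. For the other, the [F i] are replaced by the disjoint cores
    [G i] of the same measure, on which the measure is additive. *)
Lemma measure_bigcup_almost_disjoint d (T : measurableType d) (R : realType)
    (mu : {measure set T -> \bar R}) (I : choiceType) (D : {fset I})
    (F G : I -> set T) :
  (forall i, i \in D -> measurable (F i)) ->
  (forall i, i \in D -> measurable (G i)) ->
  (forall i, i \in D -> G i `<=` F i) ->
  (forall i, i \in D -> mu (F i `\` G i) = 0%E) ->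
  trivIset [set` D] G ->
  mu (\bigcup_(i in [set` D]) F i) = (\sum_(i <- D) mu (F i))%E.
Proof.
move=> mF mG GF null tG; apply/eqP; rewrite eq_le; apply/andP; split.
  rewrite fsbig_seq// content_sub_fsum//; exact: fin_bigcup_measurable.
have -> : (\sum_(i <- D) mu (F i) = \sum_(i <- D) mu (G i))%E.
  apply: eq_big_seq => i iD.
  rewrite -[in LHS](setDUK (GF i iD)) measureU0//.
  - exact: mG.
  - by apply: measurableD; [exact: mF|exact: mG].
  - exact: null.
rewrite -measure_fbigsetU// -bigcup_fset le_measure ?inE//.
- exact: fin_bigcup_measurable.
- exact: fin_bigcup_measurable.
- exact: subset_bigcup.
Qed.

(* Letting s tend to 0, the lowest exponent with a nonzero coefficient would
   dominate the sum. *)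
Lemma power_like_independent (R : realType) (N : nat) (b : R) (f : nat -> R -> R)
    (a : nat -> R) : 0 < b ->
  (forall m s, (m < N)%N -> 0 < s < 1 -> b * s ^+ m <= f m s <= s ^+ m) ->
  (forall s, 0 < s < 1 -> \sum_(m < N) a m * f m s = 0) ->
  forall m, (m < N)%N -> a m = 0.
Proof.
move=> b0 fb fs m; elim/ltn_ind: m => m IH mN.
apply/eqP/negPn/negP => am0.
pose A := \sum_(j < N) `|a j|; pose t := `|a m| * b.
have A0 : 0 <= A by apply: sumr_ge0.
have t0 : 0 < t by rewrite mulr_gt0 ?normr_gt0.
(* Chosen so that [s < 1] and [A * s < t], which contradicts the bound [t * s ^+ m <= A * s ^+ m.+1]
   derived next. *)
pose s := t / (t + A + 1).
have d0 : 0 < t + A + 1 by rewrite ltr_wpDl// addr_ge0// ltW.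
have s0 : 0 < s by rewrite divr_gt0.
have s1 : s < 1 by rewrite ltr_pdivrMr// mul1r -addrA ltrDl ltr_wpDl.
have s01 : 0 < s < 1 by rewrite s0.
have f0 j : (j < N)%N -> 0 <= f j s.
  move=> jN; have /andP[+ _] := fb j s jN s01; apply: le_trans.
  by rewrite mulr_ge0 ?exprn_ge0 ?ltW.
have : t * s ^+ m <= A * s ^+ m.+1.
  apply: (@le_trans _ _ (`|a m| * f m s)).
    by rewrite -mulrA ler_wpM2l//; have /andP[] := fb m s mN s01.
  have := fs s s01; rewrite (bigD1 (Ordinal mN))//= => /eqP.
  rewrite addr_eq0 => /eqP e.
  rewrite -[f m s]ger0_norm ?f0// -normrM e normrN.
  apply: (le_trans (ler_norm_sum _ _ _)).
  rewrite /A mulr_suml [leRHS](bigD1 (Ordinal mN))//= ler_wpDl//.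
    by rewrite mulr_ge0// exprn_ge0// ltW.
  apply: ler_sum => j jm; rewrite normrM.
  have [jm'|mj|jm'] := ltngtP j m.
  - by rewrite IH// normr0 !mul0r.
  - rewrite ler_wpM2l// ger0_norm ?f0//.
    have /andP[_ /le_trans->]// := fb j s (ltn_ord j) s01.
    by rewrite ler_wiXn2l// ltW.
  - by case/eqP: jm; exact/val_inj.
rewrite exprS mulrA ler_pM2r ?exprn_gt0// leNgt => /negP; apply.
rewrite /s mulrA ltr_pdivrMr// mulrC ltr_pM2l//.
by move: t0; clear; lra.
Qed.

Section Layers.
Variables (R : realType) (n : nat).
Local Notation E := 'rV[R]_n.

Lemma volume_std_simplex_boundary : (0 < n)%N ->
  volume (@std_simplex R n `\` @open_std_simplex R n) = 0%E.
Proof.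
move=> n0; have mN := vmeasurableD (@vmeasurable_std_simplex R n)
  (@vmeasurable_open_std_simplex R n).
rewrite volumeE; apply/negligibleP => //.
pose j0 := Ordinal n0.
(* The coordinate hyperplanes, indexed by all naturals to form a countable union; indices out of
   range repeat the hyperplane of [j0]. *)
pose F i : set E := hyperplane (delta_mx ord0 (insubd j0 i)) 0.
have nH (u : E) c : u != 0 ->
    (@lebesgue_tuple R n).-negligible (@row_of_tuple R n @^-1` hyperplane u c).
  move=> u0; apply/negligibleP; first exact: vmeasurable_hyperplane.
  exact: volume_hyperplane.
apply: (@negligibleS _ _ _ _ ((\bigcup_i (@row_of_tuple R n @^-1` F i)) `|`
    (@row_of_tuple R n @^-1` hyperplane (const_mx 1) 1))).
  move=> t /= [[y0 y1] yo].
  have [yp|/existsNP[j yj]] := pselect (forall j, 0 < row_of_tuple t ord0 j).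
    right; rewrite /hyperplane /=.
    under eq_bigr do rewrite [const_mx _ _ _]mxE mul1r.
    apply/eqP; rewrite eq_le y1 leNgt; apply/negP => ylt.
    exact: yo.
  left; exists j => //.
  rewrite /F /hyperplane /= (_ : insubd j0 j = j); last first.
    by rewrite /insubd valK.
  rewrite (bigD1 j)//= mxE !eqxx mul1r big1 ?addr0 => [|i /negPf ij].
    by apply/eqP; rewrite eq_le y0 leNgt; apply/andP; split => //; exact/negP.
  by rewrite mxE ij andbF mul0r.
apply: negligibleU.
  apply: negligible_bigcup => i; apply: nH.
  apply/eqP => /matrixP/(_ ord0 (insubd j0 i)); rewrite !mxE !eqxx.
  by move/eqP; rewrite oner_eq0.
apply: nH; apply/eqP => /matrixP/(_ ord0 j0); rewrite !mxE.
by move/eqP; rewrite oner_eq0.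
Qed.

(** The finitely many strict inequalities persist near a point because the chart is continuous. *)
Lemma open_std_simplex_interior (A : 'M[R]_n) (b : E) :
  [set x : E | open_std_simplex (x *m A + b)] `<=`
  [set x : E | std_simplex (x *m A + b)]°.
Proof.
have cj j : continuous (fun x : E => (x *m A + b) ord0 j : R).
  rewrite (_ : (fun _ => _) = fun x : E =>
    \sum_(i < n) x ord0 i * A i j + b ord0 j); last first.
    by apply/funext => x; rewrite !mxE.
  move=> x; apply: (@cvgD _ _ _ (nbhs x)); last exact: cvg_cst.
  apply: (@cvg_big _ _ +%R 0 _ _ _ (nbhs x)) => // [|i _].
    exact: add_continuous.
  by apply: (@cvgM _ _ (nbhs x)); [exact: coord_continuous|exact: cvg_cst].
have cs : continuous (fun x : E => \sum_j (x *m A + b) ord0 j : R).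
  move=> x; apply: (@cvg_big _ _ +%R 0 _ _ _ (nbhs x)) => // [|j _].
    exact: add_continuous.
  exact: cj.
move=> x [x0 x1].
have n0 : \forall y \near x, forall j, 0 < (y *m A + b) ord0 j.
  apply: (@filter_forall E 'I_n (fun j y => 0 < (y *m A + b) ord0 j) (nbhs x)).
  by move=> j; have := cj j x; move/cvgr_gt; apply; exact: x0.
have n1 : \forall y \near x, \sum_j (y *m A + b) ord0 j < 1.
  by have := cs x; move/cvgr_lt; apply; exact: x1.
have : \forall y \near x, std_simplex (y *m A + b).
  near=> y; split => [j|]; apply: ltW; last by near: y.
  by move: j; near: y.
exact.
Unshelve. all: by end_near.
Qed.

(** The affine function with value 0 on the first hyperplane and, when [c0 != c1], value 1 on the
    second. *)
Definition height (u : E) (c0 c1 : R) (x : E) : R :=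
  (\sum_(j < n) u ord0 j * x ord0 j - c0) / (c1 - c0).

(** The vertices in the first hyperplane are listed first, so vertex [j.+1] lies in the second one
    exactly when [k <= j.+1]. As [height] is affine, it is the total weight of the vertices in the
    second hyperplane. *)
Lemma simplex_chart (u : E) (c0 c1 : R) (S : {fset E}) :
  u != 0 -> c0 != c1 -> simplex S ->
  [set` S] `<=` hyperplane u c0 `|` hyperplane u c1 ->
  let k := #|` [fset v in S | v \in hyperplane u c0]%fset| in
  (0 < k)%N /\ exists (A : 'M[R]_n) (b : E), [/\ A \in unitmx,
    conv_hull [set` S] = [set x | std_simplex (x *m A + b)] &
    forall x, height u c0 c1 x =
      \sum_(j < n | (k <= j.+1)%N) (x *m A + b) ord0 j].
Proof.
move=> u0 c01 simS SH k.
pose dot (x : E) := \sum_(j < n) u ord0 j * x ord0 j.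
have dotE x : dot x = (x *m u^T) ord0 ord0.
  by rewrite mxE; apply: eq_bigr => j _; rewrite mxE mulrC.
pose s0 := [seq v <- S | v \in hyperplane u c0].
pose s := s0 ++ [seq v <- S | v \notin hyperplane u c0].
have sS : perm_eq s S by rewrite perm_filterC.
have kE : k = size s0.
  rewrite /k; apply: perm_size; apply: uniq_perm.
  - exact: fset_uniq.
  - by rewrite filter_uniq// fset_uniq.
  - by move=> v; rewrite mem_filter !inE /= andbC.
clearbody k.
have ss : size s = n.+1 by rewrite (perm_size sS) simS.1.
have uM := edge_mx_unit sS simS.
have dots j : (j < n.+1)%N -> dot s`_j = if (j < k)%N then c0 else c1.
  move=> jn; rewrite kE /s nth_cat; case: ifPn => jk.
    by have := mem_nth 0 jk; rewrite mem_filter => /andP[/set_mem].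
  have : (nth 0 [seq v <- S | v \notin hyperplane u c0] (j - size s0)) \in
      [seq v <- S | v \notin hyperplane u c0].
    rewrite mem_nth// -(ltn_add2l (size s0)) subnKC; last by rewrite leqNgt.
    by rewrite -size_cat ss.
  rewrite mem_filter => /andP[/negP vH vS].
  by have [vH0|//] := SH _ vS; case: vH; rewrite inE.
have edge j : dot (s`_j.+1 - s`_0) = dot s`_j.+1 - dot s`_0.
  by rewrite !dotE mulmxBl !mxE.
(* Otherwise every vertex lies in the second hyperplane, [u] is orthogonal to all edges, and
   invertibility of the edge matrix forces [u = 0]. *)
have k0 : (0 < k)%N.
  rewrite lt0n; apply/eqP => k_eq0; case/negP: u0.
  have : edge_mx s *m u^T = 0.
    apply/row_matrixP => j; rewrite row_mul rowK row0.
    apply/rowP => i; rewrite (ord1 i) -dotE edge !dots ?ltnS// k_eq0.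
    by rewrite subrr mxE.
  move/(congr1 (mulmx (invmx (edge_mx s)))); rewrite mulKmx// mulmx0 => /eqP.
  by rewrite trmx_eq0.
split => //; exists (invmx (edge_mx s)), (- s`_0 *m invmx (edge_mx s)).
split; first by rewrite unitmx_inv.
  rewrite (conv_hull_simplexE sS simS); apply/seteqP; split => x /=;
    by rewrite mulmxBl mulNmx.
move=> x; set y := _ + _.
have xE : x = y *m edge_mx s + s`_0.
  by rewrite /y -mulmxDl mulmxKV// subrK.
(* Vertex 0 has height 0 because [0 < k], so no constant term remains; an edge to the second
   hyperplane contributes its weight, any other edge 0. *)
rewrite /height -/(dot x) [in LHS]xE dotE mulmxDl mxE -!dotE dots// k0 addrK.
rewrite dotE [y *m _]mulmx_sum_row mulmx_suml summxE mulr_suml.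
rewrite [RHS]big_mkcond; apply: eq_bigr => j _.
rewrite rowK -scalemxAl mxE -dotE edge !dots ?ltnS// k0.
rewrite ltnNge; case: (k <= j.+1)%N => /=; last by rewrite subrr mulr0 mul0r.
by rewrite -mulrA mulfV ?mulr1// subr_eq0 eq_sym.
Qed.
End Layers.

(** * Layers of dissections *)

Section Dissections.
Variables (R : realType) (n : nat).
Local Notation E := 'rV[R]_n.
Variables (u : E) (c0 c1 : R).
Hypotheses (n_gt0 : (0 < n)%N) (u0 : u != 0) (c01 : c0 != c1).

Local Notation H0 := (hyperplane u c0).
Local Notation H1 := (hyperplane u c1).
Local Notation below s := [set x : E | height u c0 c1 x <= s].
Local Notation count0 S := #|` [fset v in S | v \in H0]%fset|.

Lemma vmeasurable_below s : vmeasurable (below s).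
Proof.
apply: (vmeasurable_le (f := height u c0 c1) (g := fun=> s)); last first.
  exact: measurable_cst.
apply: measurable_funM; last exact: measurable_cst.
by apply: measurable_funB; [exact: measurable_lin|exact: measurable_cst].
Qed.

(** One factor [c] serves all heights [s], since it comes from the linear part of the chart alone;
    the whole simplex is the slab at [s = 1]. *)
Lemma simplex_volume (S : {fset E}) : simplex S -> [set` S] `<=` H0 `|` H1 ->
  (0 < count0 S)%N /\ exists c : R,
    (forall s, volume (conv_hull [set` S] `&` below s) =
      (c%:E * volume (@slab R n (count0 S) s))%E) /\
    volume (conv_hull [set` S]) = (c%:E * volume (@slab R n (count0 S) 1))%E.
Proof.
move=> simS SH; have [k0 [A [b [uA TE hE]]]] := simplex_chart u0 c01 simS SH.
split => //; have [c _ cP] := volume_affine uA; exists c.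
have slabE s : conv_hull [set` S] `&` below s =
    [set x | slab (count0 S) s (x *m A + b)].
  by rewrite TE; apply/seteqP; split => x /= []; rewrite hE.
split => [s|]; first by rewrite slabE cP//; exact: vmeasurable_slab.
rewrite -(cP b); last exact: vmeasurable_slab.
rewrite -slabE; congr volume; apply/esym/setIidPl => x; rewrite TE /= hE.
move=> [y0 /(le_trans _)]; apply; rewrite big_mkcond; apply: ler_sum => j _.
by case: ifP.
Qed.

(** The core [G] is the open simplex in the chart. It turns disjointness of interiors into
    disjointness of measurable sets of full volume. *)
Lemma simplex_core (S : {fset E}) : simplex S -> [set` S] `<=` H0 `|` H1 ->
  vmeasurable (conv_hull [set` S]) /\ exists G : set E,
    [/\ vmeasurable G, G `<=` (conv_hull [set` S])° &
        volume (conv_hull [set` S] `\` G) = 0%E].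
Proof.
move=> simS SH; have [_ [A [b [uA TE _]]]] := simplex_chart u0 c01 simS SH.
have [c _ cP] := volume_affine uA; rewrite TE; split.
  exact: vmeasurable_affine (@vmeasurable_std_simplex R n).
exists [set x | open_std_simplex (x *m A + b)]; split.
- exact: vmeasurable_affine (@vmeasurable_open_std_simplex R n).
- exact: open_std_simplex_interior.
have := cP b _ (vmeasurableD (@vmeasurable_std_simplex R n)
  (@vmeasurable_open_std_simplex R n)).
by rewrite volume_std_simplex_boundary// mule0.
Qed.

Section OneDissection.
Variables (P : set E) (D : {fset {fset E}}).
Hypotheses (vertP : vertices P `<=` H0 `|` H1) (dissD : dissection P D).

Lemma dissection_simplex S : S \in D ->
  simplex S /\ [set` S] `<=` H0 `|` H1.
Proof.
have [DP _ _] := dissD; move=> /DP[simS SP]; split => //.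
exact: subset_trans SP vertP.
Qed.

(** The cores cut by [W] are disjoint and miss only null sets, so the volumes of the pieces add
    up. *)
Lemma dissection_volume (W : set E) : vmeasurable W ->
  volume (P `&` W) = (\sum_(S <- D) volume (conv_hull [set` S] `&` W))%E.
Proof.
move=> mW; have [_ tD PE] := dissD.
have /choice[G GP] : forall S : {fset E}, exists G : set E, S \in D ->
    [/\ vmeasurable G, G `<=` (conv_hull [set` S])° &
        volume (conv_hull [set` S] `\` G) = 0%E].
  move=> S; have [SD|] := boolP (S \in D); last by exists set0.
  have [simS SH] := dissection_simplex SD.
  by have [_ [G GP]] := simplex_core simS SH; exists G.
have mT S : S \in D -> vmeasurable (conv_hull [set` S]).
  by move=> /dissection_simplex[simS SH]; have [] := simplex_core simS SH.
pose pre (A : set E) := @row_of_tuple R n @^-1` A.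
rewrite volumeE PE setI_bigcupl preimage_bigcup.
rewrite (measure_bigcup_almost_disjoint (G := fun S => pre (G S `&` W)))//.
- by move=> S SD; apply: vmeasurableI => //; exact: mT.
- by move=> S SD; apply: vmeasurableI => //; have [] := GP S SD.
- move=> S SD t [Gt Wt]; split => //; have [_ GT _] := GP S SD.
  exact: interior_subset (GT _ Gt).
- move=> S SD; have [mG _ G0] := GP S SD.
  apply: (subset_measure0 (B := pre (conv_hull [set` S] `\` G S))) => //.
  + by apply: vmeasurableD; apply: vmeasurableI => //; exact: mT.
  + by apply: vmeasurableD => //; exact: mT.
  + by move=> t /= [[Tt Wt] /not_andP GW]; split => // Gt; case: GW.
- apply/trivIsetP => S S' SD S'D SS'.
  have [_ GT _] := GP S SD; have [_ GT' _] := GP S' S'D.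
  rewrite -subset0 => t /= [[Gt _] [Gt' _]].
  move/trivIsetP: tD => /(_ S S' SD S'D SS').
  move/seteqP => [/(_ (row_of_tuple t)) + _]; apply.
  by split; [exact: GT|exact: GT'].
Qed.

(** The sum is indexed by [m = n.+1 - k], the order of vanishing of the [k]-th slab volume at 0, as
    [power_like_independent] expects. *)
Lemma dissection_profile : exists C : nat -> R,
  (forall i, layer_volume H0 D i = ((C i)%:E * volume (@slab R n i 1))%E) /\
  (forall s, 0 < s < 1 -> volume (P `&` below s) =
    (\sum_(m < n.+1)
      C (n.+1 - m)%N * fine (volume (@slab R n (n.+1 - m) s)))%:E).
Proof.
have /choice[c cP] : forall S : {fset E}, exists c : R, S \in D ->
    [/\ (0 < count0 S)%N, (forall s, volume (conv_hull [set` S] `&` below s) =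
      (c%:E * volume (@slab R n (count0 S) s))%E) &
    volume (conv_hull [set` S]) = (c%:E * volume (@slab R n (count0 S) 1))%E].
  move=> S; have [SD|] := boolP (S \in D); last by exists 0.
  have [simS SH] := dissection_simplex SD.
  by have [k0 [c [c1P c2P]]] := simplex_volume simS SH; exists c.
have fin k s : (0 < k)%N -> 0 <= s -> volume (@slab R n k s) \is a fin_num.
  move=> k0 s0; rewrite ge0_fin_numE; last exact: volume_ge0.
  exact: le_lt_trans (volume_slab_le n k0 s0) (ltry _).
exists (fun i => \sum_(S <- D | count0 S == i) c S).
split => [i|s /andP[s0 s1]].
  (* Layer 0 is empty because every simplex has a vertex in [H0], so both sides are 0; the
     finiteness fact [fin] covers only positive indices. *)
  have [->|i0] := posnP i.
    have k_neq0 S : (S \in D) && (count0 S == 0%N) = false.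
      by apply/negP => /andP[/cP[k0 _ _] /eqP k]; rewrite k in k0.
    rewrite /layer_volume big_seq_cond (eq_bigl _ _ k_neq0) big_pred0_eq.
    by rewrite big_seq_cond (eq_bigl _ _ k_neq0) big_pred0_eq mul0e.
  rewrite -(fineK (fin i 1 i0 ler01)) -EFinM mulr_suml -sumEFin /layer_volume.
  rewrite big_seq_cond [RHS]big_seq_cond.
  apply: eq_bigr => S /andP[SD /eqP ki]; have [_ _ ->] := cP S SD.
  by rewrite EFinM fineK ?fin// ki.
rewrite dissection_volume; last exact: vmeasurable_below.
pose g k := fine (volume (@slab R n k s)).
transitivity ((\sum_(S <- D) c S * g (count0 S))%:E).
  rewrite -sumEFin; apply: eq_big_seq => S SD; have [k0 -> _] := cP S SD.
  by rewrite EFinM fineK// fin// ltW.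
congr EFin; under [RHS]eq_bigr do rewrite mulr_suml.
(* Each simplex contributes at the single index [n.+1 - count0 S], which is in range since
   [count0 S] lies between 1 and [n.+1]. *)
rewrite (exchange_big_dep xpredT)//=; apply: eq_big_seq => S SD.
have [k0 _ _] := cP S SD.
have kn : (count0 S <= n.+1)%N.
  have [[<- _] _] := dissection_simplex SD.
  by apply: fsubset_leq_card; apply/fsubsetP => v; rewrite !inE => /andP[].
have mn : (n.+1 - count0 S < n.+1)%N by rewrite ltn_subrL k0.
rewrite (big_pred1 (Ordinal mn)) /= ?subKn// => m /=.
apply/eqP/eqP => [e|->]; last by rewrite /= subKn.
by apply/val_inj; rewrite /= e subKn// ltnW.
Qed.

End OneDissection.
End Dissections.

(* Comparison of two dissections *)
Local Close Scope ring_scope.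

Theorem theorem2 (R : realType) (n : nat) (P H0 H1 : set 'rV[R]_n)
    (polyP : convex_polytope P) (dimP : full_dimensional P)
    (parH : parallel_hyperplanes H0 H1) (neqH : H0 <> H1)
    (vertP : vertices P `<=` H0 `|` H1)
    (D D' : {fset {fset 'rV[R]_n}})
    (dissD : dissection P D) (dissD' : dissection P D')
    (i : nat) (i_ge1 : (1 <= i)%N) (i_le : (i <= n)%N) :
  layer_volume H0 D i = layer_volume H0 D' i.
Proof.
have n0 : (0 < n)%N by exact: leq_trans i_le.
have [u [c0 [c1 [u0 H0E H1E]]]] := parH; subst H0 H1.
have c01 : c0 != c1 by apply: contra_notN neqH => /eqP ->.
have [C [CD CP]] := dissection_profile n0 u0 c01 vertP dissD.
have [C' [CD' CP']] := dissection_profile n0 u0 c01 vertP dissD'.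
rewrite CD CD'; congr (_%:E * _)%E; apply/eqP; rewrite -subr_eq0; apply/eqP.
(* It remains to show that the coefficient difference at [i] is 0; it is rewritten as the one
   attached to the exponent [n.+1 - i]. *)
have -> : i = (n.+1 - (n.+1 - i))%N by rewrite subKn// ltnW.
apply: (@power_like_independent R n.+1 (n.+1%:R ^- n)%R
  (fun m s => fine (volume (@slab R n (n.+1 - m) s)))
  (fun m => C (n.+1 - m)%N - C' (n.+1 - m)%N)%R).
- by rewrite invr_gt0 exprn_gt0// ltr0n.
- move=> m s mn /andP[s0 s1].
  have k0 : (0 < n.+1 - m)%N by rewrite subn_gt0.
  have s01 : (0 <= s <= 1)%R by rewrite !ltW.
  have := volume_slab_ge n k0 s01; have := volume_slab_le n k0 (ltW s0).
  rewrite subKn; last exact: ltnW.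
  by case: (volume _) => [r| |]//=; rewrite !lee_fin => -> ->.
- move=> s s01; apply/eqP.
  (* Both profiles equal the volume of the part of [P] of height at most [s], which refers to no
     dissection, so their difference vanishes. *)
  under eq_bigr do rewrite mulrBl.
  rewrite sumrB subr_eq0; apply/eqP/EFin_inj.
  by rewrite -CP// -CP'.
- by rewrite ltn_subrL i_ge1.
Qed.
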